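(* Let $M$ be a $3$-dimensional manifold and let $f:M\to \mathbb{S}^3\times\mathbb{S}^3$, $x\mapsto f(x)=(p(x),q(x))$, be a Lagrangian immersion into the nearly Kähler $\mathbb{S}^3\times\mathbb{S}^3$. If $p:M\to\mathbb{S}^3$ has nowhere maximal rank (i.e. $\operatorname{rank}(dp_x)<3$ for every $x\in M$), then $\tfrac{\pi}{3}$ is, up to a multiple of $\pi$, an angle function of $f$ (at every point). Conversely, if $\tfrac{\pi}{3}$ is, up to a multiple of $\pi$, an angle function of $f$, then $p$ has nowhere maximal rank.
   Context: Regard $\mathbb{S}^3$ as the set of unit quaternions in $\mathbb{H}$ and identify $T_{(p,q)}(\mathbb{S}^3\times\mathbb{S}^3)\cong T_p\mathbb{S}^3\oplus T_q\mathbb{S}^3$, so that tangent vectors are pairs $(U,V)$. The nearly Kähler structure on $\mathbb{S}^3\times\mathbb{S}^3$ is given by the almost complex structure $$J(U,V)_{(p,q)}=\tfrac{1}{\sqrt3}\,(2pq^{-1}V-U,\,-2qp^{-1}U+V)$$ and the metric $g(Z,Z')=\tfrac12(\langle Z,Z'\rangle+\langle JZ,JZ'\rangle)$, where $\langle\cdot,\cdot\rangle$ is the usual Euclidean product metric. The almost product structure $P$ is $P(U,V)_{(p,q)}=(pq^{-1}V,\,qp^{-1}U)$. It satisfies $P^2=\mathrm{Id}$, $PJ=-JP$, and it is symmetric and compatible with $g$. An immersion $f:M\to\mathbb{S}^3\times\mathbb{S}^3$ of a $3$-manifold is Lagrangian if $J$ maps tangent vectors of $M$ to normal vectors, so that the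 pull-back of $T(\mathbb{S}^3\times\mathbb{S}^3)$ splits orthogonally as $TM\oplus JTM$. Along a Lagrangian immersion write $PX=AX+JBX$ for $X\in TM$, with $A,B:TM\to TM$. Then $A,B$ are symmetric commuting operators with $A^2+B^2=\mathrm{Id}$. At each point there is a $g$-orthonormal basis $e_1,e_2,e_3$ of the tangent space of $M$ with $Ae_i=\cos(2\theta_i)e_i$ and $Be_i=\sin(2\theta_i)e_i$, i.e. $Pe_i=\cos(2\theta_i)e_i+\sin(2\theta_i)Je_i$. The $\theta_i$, which are determined up to multiples of $\pi$, are called the angle functions of the immersion. *)

(* Defs.v *)
(* Throughout, R : realType plays the role of the real numbers. *)
From mathcomp Require Import all_boot all_order all_algebra.
From mathcomp Require Import all_classical all_reals all_analysis.

Set Implicit Arguments.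
Unset Strict Implicit.
Unset Printing Implicit Defensive.

Import Order.TTheory GRing.Theory Num.Theory.
Import numFieldNormedType.Exports.

Local Open Scope classical_set_scope.
Local Open Scope ring_scope.

(* On an open set U of a finite-dimensional space, C^(k+1) amounts to
   differentiability together with all directional derivatives being C^k. *)
Fixpoint C_on (R : realType) (V W : normedModType R) (k : nat)
    (U : set V) (f : V -> W) : Prop :=
  match k with
  | 0 => forall x, U x -> {for x, continuous f}
  | k'.+1 => (forall x, U x -> differentiable f x) /\
             (forall v, C_on k' U (fun x => 'D_v f x))
  end.

Definition smooth_on (R : realType) (V W : normedModType R)
    (U : set V) (f : V -> W) : Prop :=
  forall k, C_on k U f.

(* The values of chart_map outside chart_dom and of chart_inv outside
   the image chart_map @` chart_dom are irrelevant. *)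
Record chart (R : realType) (E : normedModType R) (M : topologicalType) := Chart {
  chart_dom : set M;
  chart_map : M -> E;
  chart_inv : E -> M;
  chart_dom_open : open chart_dom;
  chart_img_open : open (chart_map @` chart_dom);
  chart_mapK : forall x, chart_dom x -> chart_inv (chart_map x) = x;
  chart_map_continuous :
    forall x, chart_dom x -> {for x, continuous chart_map};
  chart_inv_continuous :
    forall y, (chart_map @` chart_dom) y -> {for y, continuous chart_inv}
}.

(* A smooth manifold modelled on E (of dimension 3 when E = 'rV[R]_3).
   As part of the data a preferred chart is chosen around each point; it is
   used to identify the tangent space at that point with E. *)
Record manifold (R : realType) (E : normedModType R) := Manifold {
  carrier :> topologicalType;
  manifold_hausdorff : hausdorff_space carrier;
  manifold_second_countable : @second_countable carrier;
  atlas : set (chart E carrier);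
  chart_at : carrier -> chart E carrier;
  chart_at_atlas : forall x, atlas (chart_at x);
  chart_at_dom : forall x, chart_dom (chart_at x) x;
  atlas_compatible : forall c c', atlas c -> atlas c' ->
    smooth_on (chart_map c @` (chart_dom c `&` chart_dom c'))
              (chart_map c' \o chart_inv c)
}.

Section Differential.
Context {R : realType} {E : normedModType R} {M : manifold E}.
Context {W : normedModType R}.

(* The tangent space of M at x, read in the preferred chart. *)
Definition tangent (x : M) : normedModType R := E.

Definition smooth (f : M -> W) : Prop :=
  forall c, atlas c -> smooth_on (chart_map c @` chart_dom c) (f \o chart_inv c).

Definition mdiff (f : M -> W) (x : M) : tangent x -> W :=
  'd (f \o chart_inv (chart_at x)) (chart_map (chart_at x) x).
Arguments mdiff f x _ : clear implicits.

Definition immersion (f : M -> W) : Prop :=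
  smooth f /\ forall x, injective (mdiff f x).

End Differential.

Arguments mdiff {R E M W} f x _.

(* The rank of the differential at x of a map into a coordinate space. *)
Definition mrank (R : realType) (m n : nat) (M : manifold 'rV[R]_m)
    (f : M -> 'rV[R]_n) (x : M) : nat :=
  \rank (lin1_mx (mdiff f x : 'rV[R]_m -> 'rV[R]_n)).

(* The quaternion a + b i + c j + d k is the row vector (a, b, c, d). *)
Notation quat R := 'rV[R]_4.

Section Quaternions.
Context {R : realType}.
Implicit Types u v : quat R.

Definition mkquat (a b c d : R) : quat R := \row_(i < 4) [:: a; b; c; d]`_i.

Definition qre u : R := u 0 (inord 0).
Definition qi u : R := u 0 (inord 1).
Definition qj u : R := u 0 (inord 2).
Definition qk u : R := u 0 (inord 3).

Definition qmul u v : quat R := mkquat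
  (qre u * qre v - qi u * qi v - qj u * qj v - qk u * qk v)
  (qre u * qi v + qi u * qre v + qj u * qk v - qk u * qj v)
  (qre u * qj v - qi u * qk v + qj u * qre v + qk u * qi v)
  (qre u * qk v + qi u * qj v - qj u * qi v + qk u * qre v).

Definition qconj u : quat R := mkquat (qre u) (- qi u) (- qj u) (- qk u).

Definition qdot u v : R := \sum_(i < 4) u 0 i * v 0 i.

Definition qinv u : quat R := (qdot u u)^-1 *: qconj u.

Definition S3 : set (quat R) := [set u | qdot u u = 1].

End Quaternions.

Section NearlyKahler.
Context {R : realType}.
Local Notation HH := (quat R * quat R)%type.

(* A tangent vector of S^3 x S^3 at z = (p, q) is seen as a vector
   Z = (U, V) of H x H with U and V orthogonal to p and q respectively.
   The formulas below are those of the tensors on such vectors; they also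
   make sense on all of H x H. *)

Definition euclid (Z Z' : HH) : R := qdot Z.1 Z'.1 + qdot Z.2 Z'.2.

Definition nkJ (z Z : HH) : HH :=
  let: (p, q) := z in let: (U, V) := Z in
  (Num.sqrt 3)^-1 *: (2 *: qmul (qmul p (qinv q)) V - U,
                      - (2 *: qmul (qmul q (qinv p)) U) + V).

Definition nkg (z Z Z' : HH) : R :=
  2^-1 * (euclid Z Z' + euclid (nkJ z Z) (nkJ z Z')).

Definition nkP (z Z : HH) : HH :=
  let: (p, q) := z in let: (U, V) := Z in
  (qmul (qmul p (qinv q)) V, qmul (qmul q (qinv p)) U).

Context {M : manifold 'rV[R]_3}.

(* Smoothness and injectivity of the differential are tested in the ambient
   space H x H, in which S^3 x S^3 is an embedded submanifold. *)
Definition lagrangian_immersion (f : M -> HH) : Prop :=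
  [/\ (forall x, (S3 `*` S3) (f x)),
      immersion f &
      forall (x : M) (X Y : tangent x),
        nkg (f x) (nkJ (f x) (mdiff f x X)) (mdiff f x Y) = 0].

(* P X = A X + J B X on T_x M, tangent vectors of M being pushed forward
   by the differential of f. *)
Definition product_decomposition (f : M -> HH) (x : M)
    (A B : {linear tangent x -> tangent x}) : Prop :=
  forall X : tangent x,
    nkP (f x) (mdiff f x X) = mdiff f x (A X) + nkJ (f x) (mdiff f x (B X)).

Arguments product_decomposition f x A B : clear implicits.

Definition orthonormal_frame (f : M -> HH) (x : M)
    (e : 'I_3 -> tangent x) : Prop :=
  forall i j, nkg (f x) (mdiff f x (e i)) (mdiff f x (e j)) = (i == j)%:R.

Arguments orthonormal_frame f x e : clear implicits.

Definition angle_functions (f : M -> HH) (theta : 'I_3 -> M -> R) : Prop :=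
  forall x : M,
    exists (A B : {linear tangent x -> tangent x}) (e : 'I_3 -> tangent x),
      [/\ product_decomposition f x A B,
          orthonormal_frame f x e &
          forall i, A (e i) = cos (2 * theta i x) *: e i /\
                    B (e i) = sin (2 * theta i x) *: e i].

Definition is_angle_function (f : M -> HH) (h : M -> R) : Prop :=
  exists (theta : 'I_3 -> M -> R) (i : 'I_3),
    angle_functions f theta /\ theta i = h.

End NearlyKahler.

(* Main.v *)
Require Import Defs.
From HB Require Import structures.
From mathcomp Require Import all_boot all_order all_algebra.
From mathcomp Require Import all_classical all_reals all_analysis.
From mathcomp Require Import ring lra.
Import Order.TTheory GRing.Theory Num.Theory.
Import numFieldNormedType.Exports.

Set Implicit Arguments.
Unset Strict Implicit.
Unset Printing Implicit Defensive.

Local Open Scope classical_set_scope.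
Local Open Scope ring_scope.

(** Left translation identifies the tangent space of S^3 x S^3 at (p, q) with
    pairs (a, b) of imaginary quaternions, through U = p a and V = q b. There
    J (a, b) = (2 b - a, b - 2 a) / sqrt 3 and P (a, b) = (b, a), whatever the
    point. A tangent vector X of M lies in the kernel of dp exactly when df X
    has the form (0, b), and such a vector satisfies
      P (0, b) = (b, 0) = - 1/2 (0, b) + sqrt 3 / 2 J (0, b)
    ([ker_dp_eigen]). Conversely, a tangent vector Z = (a, b) with
    P Z = - 1/2 Z + sqrt 3 / 2 J Z has a = - a, read off the second component
    ([angle_pi3_ker]). As (- 1/2, sqrt 3 / 2) is (cos 2t, sin 2t) for
    t = pi / 3, the theorem amounts to saying that a kernel vector of dp can be
    made the first vector of a frame that diagonalizes A and B.

    So complete the normalized kernel vector to a g-orthonormal frame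
    ([orthonormal_basis3]). The Lagrangian condition makes the frame together
    with its image by J a g-orthonormal basis of the 6-dimensional tangent
    space, so that P e = A e + J B e with matrices A and B whose entries are
    scalar products; from P^2 = 1, P J = - J P and the symmetry of P it follows
    that A and B are symmetric, commute and satisfy A^2 + B^2 = 1 ([frameAB]).
    Their first rows are already diagonal, and what is left is a commuting pair
    of symmetric 2 x 2 matrices. Commutation says that the traceless parts of
    these are parallel in the plane of traceless symmetric matrices, on which
    conjugation by a rotation acts as the rotation by twice the angle: a single
    rotation diagonalizes both ([common_eigenbasis]). The diagonal entries
    lie on the unit circle because A^2 + B^2 = 1, which gives the angles.

    The angle functions are chosen point by point, without any continuity, so
    pi / 3 itself can be taken as the one attached to the kernel vector. *)

(** * Quaternions *)

Section Quaternions.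
Context {R : realType}.
Implicit Types (p q u v w : quat R) (a b : 'rV[R]_3).

Lemma qre_mkquat (a b c d : R) : qre (mkquat a b c d) = a.
Proof. by rewrite /qre mxE inordK. Qed.

Lemma qi_mkquat (a b c d : R) : qi (mkquat a b c d) = b.
Proof. by rewrite /qi mxE inordK. Qed.

Lemma qj_mkquat (a b c d : R) : qj (mkquat a b c d) = c.
Proof. by rewrite /qj mxE inordK. Qed.

Lemma qk_mkquat (a b c d : R) : qk (mkquat a b c d) = d.
Proof. by rewrite /qk mxE inordK. Qed.

Definition mkquatE := (qre_mkquat, qi_mkquat, qj_mkquat, qk_mkquat).

Lemma quatP u v :
  qre u = qre v -> qi u = qi v -> qj u = qj v -> qk u = qk v -> u = v.
Proof.
move=> h0 h1 h2 h3; apply/rowP; case=> [[|[|[|[|//]]]] hi].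
- by move: h0; rewrite /qre; congr (u _ _ = v _ _); apply/val_inj;
    rewrite /= inordK.
- by move: h1; rewrite /qi; congr (u _ _ = v _ _); apply/val_inj;
    rewrite /= inordK.
- by move: h2; rewrite /qj; congr (u _ _ = v _ _); apply/val_inj;
    rewrite /= inordK.
- by move: h3; rewrite /qk; congr (u _ _ = v _ _); apply/val_inj;
    rewrite /= inordK.
Qed.

Lemma quat_add u v :
  [/\ qre (u + v) = qre u + qre v, qi (u + v) = qi u + qi v,
      qj (u + v) = qj u + qj v & qk (u + v) = qk u + qk v].
Proof. by rewrite /qre /qi /qj /qk !mxE. Qed.

Lemma quat_scale (c : R) u :
  [/\ qre (c *: u) = c * qre u, qi (c *: u) = c * qi u,
      qj (c *: u) = c * qj u & qk (c *: u) = c * qk u].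
Proof. by rewrite /qre /qi /qj /qk !mxE. Qed.

Lemma qdotE u v :
  qdot u v = qre u * qre v + qi u * qi v + qj u * qj v + qk u * qk v.
Proof.
rewrite /qdot !big_ord_recl big_ord0 addr0 /qre /qi /qj /qk -!addrA.
by do 4?congr (_ + _); congr (u _ _ * v _ _); apply/val_inj;
  rewrite /= inordK.
Qed.

Lemma qdot_ge0 u : 0 <= qdot u u.
Proof. by apply: sumr_ge0 => i _; rewrite -expr2 sqr_ge0. Qed.

Lemma qdot_eq0 u : qdot u u = 0 -> u = 0.
Proof.
move/eqP; rewrite psumr_eq0 => [/allP H|i _]; last by rewrite -expr2 sqr_ge0.
apply/rowP => i; have := H i (mem_index_enum i).
by rewrite /= -expr2 sqrf_eq0 mxE => /eqP.
Qed.

Lemma qmul_linear p : linear (qmul p).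
Proof.
move=> c u v.
have [D0 D1 D2 D3] := quat_add (c *: qmul p u) (qmul p v).
have [Z0 Z1 Z2 Z3] := quat_scale c (qmul p u).
have [d0 d1 d2 d3] := quat_add (c *: u) v.
have [z0 z1 z2 z3] := quat_scale c u.
by apply: quatP; rewrite ?(D0, D1, D2, D3) ?(Z0, Z1, Z2, Z3) /qmul !mkquatE
  ?(d0, d1, d2, d3) ?(z0, z1, z2, z3); ring.
Qed.

HB.instance Definition _ p :=
  GRing.isLinear.Build R (quat R) (quat R) _ (qmul p) (qmul_linear p).

Lemma qmulA u v w : qmul u (qmul v w) = qmul (qmul u v) w.
Proof. by apply: quatP; rewrite /qmul !mkquatE; ring. Qed.

Lemma qmulVK q v : S3 q -> qmul (qinv q) (qmul q v) = v.
Proof.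
rewrite /S3 /= => hq; rewrite /qinv hq invr1 scale1r.
by apply: quatP; rewrite /qmul /qconj !mkquatE -[RHS]mul1r -hq qdotE; ring.
Qed.

Lemma qmulKV q v : S3 q -> qmul q (qmul (qinv q) v) = v.
Proof.
rewrite /S3 /= => hq; rewrite /qinv hq invr1 scale1r.
by apply: quatP; rewrite /qmul /qconj !mkquatE -[RHS]mul1r -hq qdotE; ring.
Qed.

Lemma qdot_qmull p u v : S3 p -> qdot (qmul p u) (qmul p v) = qdot u v.
Proof.
by rewrite /S3 /= => hp; rewrite -[RHS]mul1r -hp !qdotE /qmul !mkquatE; ring.
Qed.

(** Vectors orthogonal to q are the left translates by q of imaginary
    quaternions. *)
Lemma qre_qinv_mul q v : S3 q -> qre (qmul (qinv q) v) = qdot q v.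
Proof.
rewrite /S3 /= => hq; rewrite /qinv hq invr1 scale1r.
by rewrite qdotE /qmul /qconj !mkquatE; ring.
Qed.

Definition quat_of_im a : quat R :=
  mkquat 0 (a 0 (inord 0)) (a 0 (inord 1)) (a 0 (inord 2)).

Definition im_part u : 'rV[R]_3 := \row_(i < 3) [:: qi u; qj u; qk u]`_i.

Lemma quat_of_im_linear : linear quat_of_im.
Proof.
move=> c a b.
have [D0 D1 D2 D3] := quat_add (c *: quat_of_im a) (quat_of_im b).
have [Z0 Z1 Z2 Z3] := quat_scale c (quat_of_im a).
by apply: quatP; rewrite ?(D0, D1, D2, D3) ?(Z0, Z1, Z2, Z3) /quat_of_im
  !mkquatE ?mxE; ring.
Qed.

HB.instance Definition _ :=
  GRing.isLinear.Build R 'rV[R]_3 (quat R) _ quat_of_im quat_of_im_linear.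

Lemma im_partK u : qre u = 0 -> quat_of_im (im_part u) = u.
Proof.
by move=> u0; apply: quatP; rewrite /quat_of_im !mkquatE ?u0 // mxE inordK.
Qed.

Lemma quat_of_imK a : im_part (quat_of_im a) = a.
Proof.
apply/rowP; case=> [[|[|[|//]]]] hi; rewrite mxE /= /quat_of_im mkquatE;
by congr (a _ _); apply/val_inj; rewrite /= inordK.
Qed.

Lemma qdot_im a b : qdot (quat_of_im a) (quat_of_im b) = (a *m b^T) 0 0.
Proof.
rewrite qdotE /quat_of_im !mkquatE mul0r add0r.
rewrite mxE !big_ord_recl big_ord0 addr0 !mxE -!addrA.
by do 3?congr (_ + _); congr (a _ _ * b _ _); apply/val_inj;
  rewrite /= inordK.
Qed.

End Quaternions.

(** * The nearly Kaehler structure in left-translated coordinates *)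

Section LeftTranslation.
Context {R : realType}.
Local Notation HH := (quat R * quat R)%type.
Implicit Types (z : HH) (w : 'rV[R]_(3 + 3)).

(** Coordinates (a, b) are row vectors, on which matrices act from the right:
    J sends the vector of coordinates w to that of coordinates w *m nkJmx. *)
Definition nkJmx : 'M[R]_(3 + 3) :=
  (Num.sqrt 3)^-1 *: block_mx (-1)%:M (-2)%:M 2%:M 1%:M.
Definition nkPmx : 'M[R]_(3 + 3) := block_mx 0 1%:M 1%:M 0.
Definition nkGmx : 'M[R]_(3 + 3) :=
  (2 / 3) *: block_mx 2%:M (-1)%:M (-1)%:M 2%:M.

Lemma sqrt3_neq0 : Num.sqrt 3 != 0 :> R.
Proof. by rewrite sqrtr_eq0 -ltNge. Qed.

Lemma sqrt3VV : (Num.sqrt 3)^-1 * (Num.sqrt 3)^-1 = (3 : R)^-1.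
Proof. by rewrite -invfM -expr2 sqr_sqrtr. Qed.

Lemma eq_block_scalar (a b c d a' b' c' d' : R) :
  a = a' -> b = b' -> c = c' -> d = d' ->
  block_mx a%:M b%:M c%:M d%:M =
    block_mx (a')%:M (b')%:M (c')%:M (d')%:M :> 'M[R]_(3 + 3).
Proof. by move=> -> -> -> ->. Qed.

Lemma nkJmx2 : nkJmx *m nkJmx = - 1%:M.
Proof.
rewrite /nkJmx -scalemxAl -scalemxAr scalerA sqrt3VV mulmx_block.
rewrite -!scalar_mxM -!raddfD /= scale_block_mx !scale_scalar_mx.
rewrite (scalar_mx_block 3 3) opp_block_mx.
rewrite -[0](raddf0 (@scalar_mx R 3)) -!raddfN /=.
by apply: eq_block_scalar; field.
Qed.

Lemma nkPmx2 : nkPmx *m nkPmx = 1%:M.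
Proof.
rewrite /nkPmx mulmx_block !mulmx1 !mulmx0 !addr0 !add0r.
by rewrite -scalar_mx_block.
Qed.

Lemma nkPJmx : nkPmx *m nkJmx = - (nkJmx *m nkPmx).
Proof.
rewrite /nkJmx /nkPmx -[0](raddf0 (@scalar_mx R 3)).
rewrite -scalemxAr -scalemxAl !mulmx_block -!scalar_mxM -!raddfD /=.
rewrite !scale_block_mx !scale_scalar_mx opp_block_mx -!raddfN /=.
by apply: eq_block_scalar; ring.
Qed.

Lemma nkPGmx : nkPmx *m nkGmx = nkGmx *m nkPmx^T.
Proof.
rewrite /nkGmx /nkPmx -[0](raddf0 (@scalar_mx R 3)) -scalemxAr -scalemxAl.
rewrite tr_block_mx !tr_scalar_mx !mulmx_block.
rewrite -!scalar_mxM -!raddfD /= !scale_block_mx !scale_scalar_mx.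
by apply: eq_block_scalar; ring.
Qed.

Lemma nkJGmx : nkJmx *m nkGmx = - (nkGmx *m nkJmx^T).
Proof.
rewrite /nkGmx /nkJmx [(_ *: _)^T]linearZ /= tr_block_mx !tr_scalar_mx.
rewrite -!scalemxAr -!scalemxAl !mulmx_block -scalerN.
rewrite -!scalar_mxM -!raddfD /= !scale_block_mx !scale_scalar_mx.
rewrite opp_block_mx -!raddfN /= scale_block_mx !scale_scalar_mx.
by apply: eq_block_scalar; ring.
Qed.

Lemma nkGmx_sym : nkGmx^T = nkGmx.
Proof. by rewrite /nkGmx [(_ *: _)^T]linearZ /= tr_block_mx !tr_scalar_mx. Qed.

(** This is the definition of g, since the euclidean metric is preserved by
    left translations. *)
Lemma nkGmxE : nkGmx = 2^-1 *: (1%:M + nkJmx *m nkJmx^T).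
Proof.
rewrite /nkGmx /nkJmx [(_ *: _)^T]linearZ /= tr_block_mx !tr_scalar_mx.
rewrite -scalemxAl -scalemxAr scalerA sqrt3VV mulmx_block.
rewrite (scalar_mx_block 3 3) -[0](raddf0 (@scalar_mx R 3)).
rewrite -!scalar_mxM -!raddfD /= !scale_block_mx !scale_scalar_mx.
rewrite add_block_mx -!raddfD scale_block_mx !scale_scalar_mx.
by apply: eq_block_scalar; field.
Qed.

Lemma mul_nkJmx (a b : 'rV[R]_3) : row_mx a b *m nkJmx =
  (Num.sqrt 3)^-1 *: row_mx (2 *: b - a) (b - 2 *: a).
Proof.
rewrite /nkJmx -scalemxAr mul_row_block; congr (_ *: row_mx _ _);
by rewrite !mul_mx_scalar ?scaleN1r ?scaleNr ?scale1r addrC.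
Qed.

Lemma mul_nkPmx (a b : 'rV[R]_3) : row_mx a b *m nkPmx = row_mx b a.
Proof. by rewrite /nkPmx mul_row_block !mulmx1 !mulmx0 addr0 add0r. Qed.

Definition ltrans z w : HH :=
  (qmul z.1 (quat_of_im (lsubmx w)), qmul z.2 (quat_of_im (rsubmx w))).

Definition ltrans_coord z (Z : HH) : 'rV[R]_(3 + 3) :=
  row_mx (im_part (qmul (qinv z.1) Z.1)) (im_part (qmul (qinv z.2) Z.2)).

Lemma ltrans_linear z : linear (ltrans z).
Proof. by move=> c w w'; rewrite /ltrans !linearP. Qed.

HB.instance Definition _ z :=
  GRing.isLinear.Build R 'rV[R]_(3 + 3) HH _ (ltrans z) (ltrans_linear z).

Lemma ltransZ z c w : ltrans z (c *: w) = c *: ltrans z w.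
Proof. exact: linearZ. Qed.

Lemma ltrans_row z (a b : 'rV[R]_3) :
  ltrans z (row_mx a b) = (qmul z.1 (quat_of_im a), qmul z.2 (quat_of_im b)).
Proof. by rewrite /ltrans row_mxKl row_mxKr. Qed.

Lemma ltrans_coordK z (Z : HH) : (S3 `*` S3) z ->
  qdot z.1 Z.1 = 0 -> qdot z.2 Z.2 = 0 -> ltrans z (ltrans_coord z Z) = Z.
Proof.
case: z Z => p q [U V] [/= hp hq] hU hV.
rewrite /ltrans /ltrans_coord /= row_mxKl row_mxKr.
by rewrite !im_partK ?qre_qinv_mul // !qmulKV.
Qed.

Lemma nkJ_ltrans z w : (S3 `*` S3) z ->
  nkJ z (ltrans z w) = ltrans z (w *m nkJmx).
Proof.
case: z => p q [/= hp hq]; rewrite -[w]hsubmxK.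
move: (lsubmx w) (rsubmx w) => a b.
rewrite mul_nkJmx ltransZ ltrans_row /= !row_mxKl !row_mxKr.
congr (_ *: (_, _)).
  by rewrite -!qmulA qmulVK //= !linearB /= !linearZ.
by rewrite -!qmulA qmulVK //= !linearB /= !linearZ addrC.
Qed.

Lemma nkP_ltrans z w : (S3 `*` S3) z ->
  nkP z (ltrans z w) = ltrans z (w *m nkPmx).
Proof.
case: z => p q [/= hp hq]; rewrite -[w]hsubmxK.
move: (lsubmx w) (rsubmx w) => a b.
by rewrite mul_nkPmx ltrans_row /= !row_mxKl !row_mxKr -!qmulA !qmulVK.
Qed.

Lemma euclid_ltrans z w w' : (S3 `*` S3) z ->
  euclid (ltrans z w) (ltrans z w') = (w *m w'^T) 0 0.
Proof.
case: z => p q [/= hp hq]; rewrite -[w]hsubmxK -[w']hsubmxK.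
move: (lsubmx w) (rsubmx w) (lsubmx w') (rsubmx w') => a b c d.
rewrite !ltrans_row /euclid /= !qdot_qmull // !qdot_im.
by rewrite tr_row_mx mul_row_col [in RHS]mxE.
Qed.

Lemma nkg_ltrans z w w' : (S3 `*` S3) z ->
  nkg z (ltrans z w) (ltrans z w') = (w *m nkGmx *m w'^T) 0 0.
Proof.
move=> hz; rewrite /nkg !nkJ_ltrans // !euclid_ltrans // nkGmxE.
rewrite -(scalemxAr 2^-1) -(scalemxAl 2^-1) mulmxDr mulmxDl mulmx1.
by rewrite trmx_mul !mulmxA [in RHS]mxE [in RHS]mxE.
Qed.

Lemma nkg_gt0 (z Z : HH) : Z != 0 -> 0 < nkg z Z Z.
Proof.
move=> Z0; rewrite /nkg pmulr_rgt0 ?invr_gt0 //.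
have eu0 (W : HH) : 0 <= euclid W W by rewrite addr_ge0 ?qdot_ge0.
apply: ltr_pwDl (eu0 _); rewrite lt_neqAle eu0 andbT eq_sym.
apply: contra Z0; rewrite paddr_eq0 ?qdot_ge0 //.
case/andP=> /eqP/qdot_eq0 h1 /eqP/qdot_eq0 h2.
by rewrite (surjective_pairing Z) h1 h2.
Qed.

Lemma ker_dp_eigen (b : 'rV[R]_3) : row_mx 0 b *m nkPmx =
  - 2^-1 *: row_mx 0 b + (Num.sqrt 3 / 2) *: (row_mx 0 b *m nkJmx).
Proof.
have s0 := sqrt3_neq0.
rewrite mul_nkPmx mul_nkJmx !scale_row_mx add_row_mx.
rewrite !scaler0 !subr0 add0r !scalerA.
congr row_mx; first by rewrite (_ : _ * 2 = 1) ?scale1r //; field.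
by rewrite -scalerDl (_ : _ + _ = 0) ?scale0r //; field.
Qed.

Lemma angle_pi3_ker (z Z : HH) : (S3 `*` S3) z ->
  nkP z Z = - 2^-1 *: Z + nkJ z ((Num.sqrt 3 / 2) *: Z) -> Z.1 = 0.
Proof.
have s0 := sqrt3_neq0.
(* Second components, with Y = q p^-1 U: the terms in V cancel. *)
have key (Y V : quat R) : Y = - 2^-1 *: V + (Num.sqrt 3)^-1 *:
    (- (2 *: ((Num.sqrt 3 / 2) *: Y)) + (Num.sqrt 3 / 2) *: V) -> Y = 0.
  move=> H; apply/rowP => i; have /rowP/(_ i) := H; rewrite !mxE => Hi.
  have : Y 0 i = - Y 0 i by rewrite {1}Hi; field.
  by move=> ?; lra.
case: z Z => p q [U V] [/= hp hq] [_].
rewrite [qmul _ (_ *: U)]linearZ => H; have {H} := key _ V H.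
rewrite -qmulA => /(congr1 (qmul (qinv q))); rewrite qmulVK // raddf0.
by move=> /(congr1 (qmul p)); rewrite qmulKV // raddf0.
Qed.

End LeftTranslation.

(** * The operators A and B in a Lagrangian orthonormal frame *)

(** Here J, P and the Gram matrix G are abstract, subject to the identities of
    an almost complex structure and a compatible almost product structure; the
    rows of Z span a Lagrangian subspace and are orthonormal. *)
Section LagrangianFrame.
Context {F : fieldType} {n : nat}.
Context (J P G : 'M[F]_(n + n)).
Context (J2 : J *m J = - 1%:M) (P2 : P *m P = 1%:M).
Context (PJ : P *m J = - (J *m P)) (JG : J *m G = - (G *m J^T)).
Context (PG : P *m G = G *m P^T) (Gsym : G^T = G).
Context (Z : 'M[F]_(n, n + n)).
Context (Zon : Z *m G *m Z^T = 1%:M) (Zlag : Z *m J *m G *m Z^T = 0).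

Definition frameA := Z *m P *m G *m Z^T.
Definition frameB := Z *m P *m G *m (Z *m J)^T.

Lemma frame_JJ : Z *m J *m G *m (Z *m J)^T = 1%:M.
Proof.
rewrite trmx_mul !mulmxA -(mulmxA (Z *m J)) -[G *m J^T]opprK -JG.
rewrite mulmxN mulNmx mulmxA -(mulmxA Z) J2.
by rewrite mulmxN mulmx1 !mulNmx opprK.
Qed.

Lemma frame_ZJ : Z *m G *m (Z *m J)^T = 0.
Proof.
rewrite trmx_mul !mulmxA -(mulmxA Z) -[G *m J^T]opprK -JG.
by rewrite mulmxN mulNmx !mulmxA Zlag oppr0.
Qed.

(** The rows of Z and of Z J are 2n orthonormal vectors in dimension 2n, so
    the square matrix K that they form has inverse G K^T on both sides. *)
Lemma frame_coord m (X : 'M[F]_(m, n + n)) :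
  X = X *m G *m Z^T *m Z + X *m G *m (Z *m J)^T *m (Z *m J).
Proof.
pose K := col_mx Z (Z *m J).
have KGK : K *m (G *m K^T) = 1%:M.
  rewrite mulmxA /K tr_col_mx mul_col_mx mul_col_row.
  by rewrite Zon Zlag frame_ZJ frame_JJ -scalar_mx_block.
have {1}-> : X = X *m G *m K^T *m K.
  by rewrite -!mulmxA [G *m _]mulmxA (mulmx1C KGK) mulmx1.
by rewrite /K tr_col_mx mul_mx_row mul_row_col.
Qed.

Lemma frame_free m (X Y : 'M[F]_(m, n)) :
  X *m Z + Y *m (Z *m J) = 0 -> X = 0 /\ Y = 0.
Proof.
move=> H; split.
  have := congr1 (fun W => W *m G *m Z^T) H.
  rewrite !mulmxDl -!mulmxA [Z *m (G *m _)]mulmxA Zon !mulmxA.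
  rewrite -(mulmxA _ Z) -(mulmxA _ _ G) -(mulmxA _ _ Z^T) Zlag.
  by rewrite mulmx0 mulmx1 addr0 !mul0mx.
have := congr1 (fun W => W *m G *m (Z *m J)^T) H.
rewrite !mulmxDl -!(mulmxA X) frame_ZJ -(mulmxA Y) -(mulmxA Y) frame_JJ.
by rewrite mulmx0 mulmx1 add0r !mul0mx.
Qed.

Lemma frame_decomp : Z *m P = frameA *m Z + frameB *m (Z *m J).
Proof. exact: frame_coord. Qed.

Lemma frameA_sym : frameA^T = frameA.
Proof.
by rewrite /frameA !trmx_mul trmxK Gsym !mulmxA -(mulmxA Z G) -PG !mulmxA.
Qed.

(** Moving P, then J, across the form changes the sign twice: P anticommutes
    with J, and J is skew. *)
Lemma frameB_sym : frameB^T = frameB.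
Proof.
rewrite /frameB !trmx_mul !trmxK Gsym !mulmxA.
rewrite -(mulmxA _ G P^T) -PG !mulmxA -(mulmxA Z J) -[J *m P]opprK -PJ.
rewrite -(mulmxA _ G J^T) -[G *m J^T]opprK -JG.
by rewrite !mulmxN !mulNmx !mulmxA.
Qed.

(** Expand P (P Z) = Z in the basis formed by Z and Z J. *)
Lemma frameAB : frameA *m frameA + frameB *m frameB = 1%:M /\
  frameA *m frameB = frameB *m frameA.
Proof.
move: frame_decomp; move: frameA frameB => A B dec.
have H : (A *m A + B *m B - 1%:M) *m Z +
         (A *m B - B *m A) *m (Z *m J) = 0.
  have E : Z = (A *m A + B *m B) *m Z + (A *m B - B *m A) *m (Z *m J).
    rewrite -{1}[Z]mulmx1 -P2 mulmxA dec mulmxDl.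
    have -> : B *m (Z *m J) *m P = - (B *m (Z *m P *m J)).
      by rewrite -!mulmxA -[J *m P]opprK -PJ !mulmxN.
    rewrite -[A *m Z *m P]mulmxA dec [(_ + _ *m (Z *m J)) *m J]mulmxDl.
    rewrite !mulmxDr -!(mulmxA B) -(mulmxA Z) J2.
    rewrite !mulmxN mulmx1 !mulmxDl !mulmxA mulNmx.
    by rewrite mulNmx opprB addrACA.
  by rewrite mulmxBl mul1mx addrAC -E subrr.
have [/eqP + /eqP] := frame_free H.
by rewrite !subr_eq0 => /eqP ? /eqP ?.
Qed.

Lemma frame_row (i : 'I_n) (l m : F) :
  row i Z *m P = l *: row i Z + m *: (row i Z *m J) ->
  row i frameA = l *: row i 1%:M /\ row i frameB = m *: row i 1%:M.
Proof.
move=> H; have ZJZ := frame_ZJ; have ZJJ := frame_JJ.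
have rowM p q (U : 'M[F]_(n, p)) (V : 'M[F]_(p, q)) :
    row i U *m V = row i (U *m V) by rewrite row_mul.
rewrite /frameA /frameB !row_mul H !mulmxDl -!scalemxAl !rowM.
by rewrite Zon Zlag ZJZ ZJJ !row0 !scaler0 addr0 add0r.
Qed.

End LagrangianFrame.

(** * Angles and planar rotations *)

Section Angles.
Context {R : realType}.

Lemma polar_angle (x y : R) : x ^+ 2 + y ^+ 2 = 1 ->
  exists t, cos t = x /\ sin t = y.
Proof.
move=> xy1.
have hx : -1 <= x <= 1 by apply/andP; split; nra.
have cx : cos (acos x) = x by apply: acosK; rewrite in_itv.
have sx : sin (acos x) = `|y|.
  by rewrite sin_acos // -xy1 addrC addKr sqrtr_sqr.
have [y0|y0] := ger0P y; first by exists (acos x); rewrite cx sx ger0_norm.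
by exists (- acos x); rewrite cosN sinN cx sx ltr0_norm ?opprK.
Qed.

Lemma double_polar_angle (x y : R) : x ^+ 2 + y ^+ 2 = 1 ->
  exists t, cos (2 * t) = x /\ sin (2 * t) = y.
Proof. by move=> /polar_angle[t]; exists (t / 2); rewrite mulrC divfK. Qed.

(** From sin (3 t) = sin t (3 cos^2 t - sin^2 t), which vanishes at
    t = pi / 3. *)
Lemma cos_sin_2pi3 : cos (2 * (pi / 3)) = - 2^-1 :> R /\
  sin (2 * (pi / 3)) = Num.sqrt 3 / 2 :> R.
Proof.
set t : R := pi / 3.
have pi0 := pi_gt0 R.
have s0 : 0 < sin t by apply: sin_gt0_pi; rewrite /t; lra.
have c0 : 0 < cos t by apply: cos_gt0_pihalf; rewrite /t; lra.
have e2 : 2 * t = t + t by lra.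
have s3 : sin (t + t + t) = 0.
  by rewrite (_ : t + t + t = pi) ?sinpi // /t; lra.
have cs := cos2Dsin2 t.
move: s3; rewrite e2 sinD cosD sinD => s3.
have sc : (sin t) * (4 * (cos t) ^+ 2 - 1) = 0.
  have -> : 4 * (cos t) ^+ 2 - 1 = 3 * cos t ^+ 2 - sin t ^+ 2 by lra.
  by rewrite -[RHS]s3; ring.
have c2 : cos t ^+ 2 = 4^-1.
  by move: sc => /eqP; rewrite mulf_eq0 gt_eqF //= => /eqP; lra.
have ct : cos t = 2^-1 by nra.
split; first by rewrite ct in cs *; lra.
rewrite ct (_ : sin t / 2 + _ = sin t); last by lra.
have : sin t ^+ 2 = (Num.sqrt 3 / 2) ^+ 2.
  by rewrite expr_div_n sqr_sqrtr //; rewrite ct in cs; lra.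
by move/eqP; rewrite eqrXn2 ?ltW ?divr_ge0 ?sqrtr_ge0 // => /eqP.
Qed.

Lemma cos_sin_double_periodz (a : R) (k : int) :
  cos (2 * (a + k%:~R * pi)) = cos (2 * a) /\
  sin (2 * (a + k%:~R * pi)) = sin (2 * a).
Proof.
have H (n : nat) b : cos (2 * (b + n%:R * pi)) = cos (2 * b) /\
                     sin (2 * (b + n%:R * pi)) = sin (2 * b) :> R.
  have -> : 2 * (b + n%:R * pi) = 2 * b + (pi *+ 2) *+ n :> R.
    by rewrite -mulrnA -[pi *+ _]mulr_natl natrM; ring.
  by rewrite (periodicn (@cosD2pi R)) (periodicn (@sinD2pi R)).
case: k => n; first exact: H.
rewrite NegzE mulrNz mulNr; have [<- <-] := H n.+1 (a - n.+1%:R * pi).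
by rewrite subrK.
Qed.

Lemma sumsq_double_eq0 (x y : R) :
  x ^+ 2 + (2 * y) ^+ 2 = 0 -> x = 0 /\ y = 0.
Proof.
move=> /eqP; rewrite paddr_eq0 ?sqr_ge0 // !sqrf_eq0 mulf_eq0 pnatr_eq0 /=.
by case/andP=> /eqP -> /eqP ->.
Qed.

(** For a symmetric 2 x 2 matrix with diagonal a, d and off-diagonal entry v,
    put u = a - d: the two conclusions say that the rotation (c, s) kills the
    off-diagonal entry. They mean that (cos 2t, sin 2t) is parallel to (u, 2 v),
    hence can be met for (u', v') as well when that pair is parallel to
    (u, v). *)
Lemma common_rotation (u v u' v' : R) : u * v' = u' * v ->
  exists c s : R, [/\ c ^+ 2 + s ^+ 2 = 1,
    v * (c ^+ 2 - s ^+ 2) = u * (c * s) &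
    v' * (c ^+ 2 - s ^+ 2) = u' * (c * s)].
Proof.
move=> par.
wlog uv0 : u v u' v' par / u ^+ 2 + (2 * v) ^+ 2 != 0.
  move=> H; have [uv0|] := eqVneq (u ^+ 2 + (2 * v) ^+ 2) 0; last exact: H.
  have [u0 v0] := sumsq_double_eq0 uv0.
  have [uv0'|/H] := eqVneq (u' ^+ 2 + (2 * v') ^+ 2) 0.
    have [u0' v0'] := sumsq_double_eq0 uv0'.
    by exists 1, 0; rewrite u0 v0 u0' v0'; split; ring.
  by case/(_ u v (esym par)) => c [s [? ? ?]]; exists c, s.
pose r := Num.sqrt (u ^+ 2 + (2 * v) ^+ 2).
have r2 : r ^+ 2 = u ^+ 2 + (2 * v) ^+ 2.
  by rewrite sqr_sqrtr // addr_ge0 ?sqr_ge0.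
have r0 : r != 0 by rewrite -sqrf_eq0 r2.
have [|t [ct st]] := @double_polar_angle (u / r) (2 * v / r).
  by rewrite !expr_div_n -mulrDl -r2 divff // sqrf_eq0.
move: ct st; rewrite (_ : 2 * t = t + t) ?cosD ?sinD; last by lra.
rewrite -!expr2 => ct st.
exists (cos t), (sin t); split; first exact: cos2Dsin2.
  by rewrite ct (_ : cos t * sin t = v / r); [field | lra].
rewrite ct (_ : cos t * sin t = v / r); last by lra.
by rewrite !mulrA [v' * u]mulrC par.
Qed.

End Angles.

(** * Orthonormal bases and common eigenbases *)

Section GramSchmidt.
Context {R : rcfType} {n : nat}.
Context (G : 'M[R]_n) (Gsym : G^T = G).
Context (Gpos : forall v : 'rV_n, v != 0 -> 0 < (v *m G *m v^T) 0 0).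

Lemma normalize (v : 'rV_n) : v != 0 ->
  exists2 c : R, c != 0 & (c *: v) *m G *m (c *: v)^T = 1%:M.
Proof.
move=> /Gpos; set g := (_ 0 0) => g0.
exists (Num.sqrt g)^-1; first by rewrite invr_eq0 sqrtr_eq0 -ltNge.
rewrite -!scalemxAl [(_ *: _)^T]linearZ /= -scalemxAr scalerA.
rewrite [v *m G *m v^T]mx11_scalar -/g scale_scalar_mx -invfM -expr2.
by rewrite sqr_sqrtr ?ltW // mulVf ?gt_eqF.
Qed.

(** Fewer than n linear equations in n unknowns leave a nonzero vector
    orthogonal to E. *)
Lemma extend_orthonormal k (E : 'M[R]_(k, n)) :
  (k < n)%N -> E *m G *m E^T = 1%:M ->
  exists v : 'rV_n, col_mx E v *m G *m (col_mx E v)^T = 1%:M.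
Proof.
move=> kn EG.
have : kermx (G *m E^T) != 0.
  rewrite kermx_eq0 /row_free; apply/negP => /eqP rk.
  by have := rank_leq_col (G *m E^T); rewrite rk leqNgt kn.
case/rowV0Pn => u; rewrite sub_kermx mulmxA => /eqP uE u0.
have [c c0 uu] := normalize u0.
exists (c *: u).
rewrite tr_col_mx mul_col_mx mul_col_row EG uu.
have vE : c *: u *m G *m E^T = 0 by rewrite -!scalemxAl uE scaler0.
rewrite vE; have -> : E *m G *m (c *: u)^T = 0.
  by apply: trmx_inj; rewrite !trmx_mul trmxK Gsym mulmxA vE trmx0.
by rewrite -scalar_mx_block.
Qed.

End GramSchmidt.

Lemma orthonormal_basis3 (R : rcfType) (G : 'M[R]_3) (v : 'rV_3) :
  G^T = G -> (forall v : 'rV_3, v != 0 -> 0 < (v *m G *m v^T) 0 0) ->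
  v != 0 ->
  exists (E : 'M[R]_3) (c : R), E *m G *m E^T = 1%:M /\ row 0 E = c *: v.
Proof.
move=> Gs Gp v0; have [c c0 H1] := normalize Gp v0.
have [w H2] := extend_orthonormal Gs Gp (isT : 1 < 3)%N H1.
have [x H3] := extend_orthonormal Gs Gp (isT : 1 + 1 < 3)%N H2.
exists (col_mx (col_mx (c *: v) w) x), c; split=> //.
apply/rowP => j.
have <- : col_mx (col_mx (c *: v) w) x (lshift 1 (lshift 1 0)) j =
          (c *: v) 0 j by rewrite !col_mxEu.
by rewrite [LHS]mxE; congr (fun_of_matrix _ _ j); apply/val_inj.
Qed.

Section CommonEigenbasis.
Context {R : realType}.
Implicit Types A B : 'M[R]_3.

Definition axis_rotation (c s : R) : 'M[R]_3 := \matrix_(i, j)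
  nth 0 (nth [::] [:: [:: 1; 0; 0]; [:: 0; c; s]; [:: 0; - s; c]] i) j.

Lemma sum3 (F : 'I_3 -> R) : \sum_i F i = F 0 + F 1 + F 2%:R.
Proof.
rewrite !big_ord_recl big_ord0 addr0 addrA.
by congr (F _ + F _ + F _); apply/val_inj.
Qed.

Lemma ord3P (P : 'I_3 -> Prop) : P 0 -> P 1 -> P 2%:R -> forall i, P i.
Proof.
move=> P0 P1 P2; case=> [[|[|[|//]]]] hi.
- by move: P0; congr P; apply/val_inj.
- by move: P1; congr P; apply/val_inj.
- by move: P2; congr P; apply/val_inj.
Qed.

Lemma axis_rotation_orthogonal c s : c ^+ 2 + s ^+ 2 = 1 ->
  axis_rotation c s *m (axis_rotation c s)^T = 1%:M.
Proof.
move=> cs; apply/matrixP; elim/ord3P; elim/ord3P;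
by rewrite !mxE sum3 !mxE /=; lra.
Qed.

Lemma axis_rotation_diag A (l c s : R) :
  A^T = A -> row 0 A = l *: row 0 1%:M ->
  A 1 2%:R * (c ^+ 2 - s ^+ 2) = (A 1 1 - A 2%:R 2%:R) * (c * s) ->
  exists d : 'rV_3, d 0 0 = l /\
    axis_rotation c s *m A *m (axis_rotation c s)^T = diag_mx d.
Proof.
move=> As A0 Ecs.
have sym i j : A i j = A j i by rewrite -[in LHS]As mxE.
have a00 : A 0 0 = l by have /rowP/(_ 0) := A0; rewrite !mxE /= mulr1.
have a01 : A 0 1 = 0 by have /rowP/(_ 1) := A0; rewrite !mxE /= mulr0.
have a02 : A 0 2%:R = 0.
  by have /rowP/(_ 2%:R) := A0; rewrite !mxE /= mulr0.
exists (\row_j (axis_rotation c s *m A *m (axis_rotation c s)^T) j j); split.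
  by rewrite !mxE sum3 !mxE !sum3 !mxE /= a00; ring.
apply/matrixP => i j; rewrite [RHS]mxE [in RHS]mxE.
have [->|ij] := eqVneq i j; first by rewrite mulr1n.
rewrite mulr0n; move: ij.
elim/ord3P: i; elim/ord3P: j => //= _;
rewrite !mxE !sum3 !mxE !sum3 !mxE /=
  ?(sym 1 0) ?(sym 2%:R 0) ?(sym 2%:R 1) ?a00 ?a01 ?a02; try ring.
all: by lra.
Qed.

Lemma common_eigenbasis A B (l m : R) :
  A^T = A -> B^T = B -> A *m B = B *m A ->
  row 0 A = l *: row 0 1%:M -> row 0 B = m *: row 0 1%:M ->
  exists (Q : 'M[R]_3) (a b : 'rV[R]_3),
    [/\ Q *m Q^T = 1%:M, a 0 0 = l, b 0 0 = m,
        Q *m A *m Q^T = diag_mx a & Q *m B *m Q^T = diag_mx b].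
Proof.
move=> As Bs AB A0 B0.
have symA i j : A i j = A j i by rewrite -[in LHS]As mxE.
have symB i j : B i j = B j i by rewrite -[in LHS]Bs mxE.
(* Up to symmetry, this is the only nontrivial entry of A B = B A. *)
have par : (A 1 1 - A 2%:R 2%:R) * B 1 2%:R =
           (B 1 1 - B 2%:R 2%:R) * A 1 2%:R.
  have a01 : A 0 1 = 0 by have /rowP/(_ 1) := A0; rewrite !mxE /= mulr0.
  have b01 : B 0 1 = 0 by have /rowP/(_ 1) := B0; rewrite !mxE /= mulr0.
  have := congr1 (fun W : 'M[R]_3 => W 1 2%:R) AB.
  rewrite !mxE !sum3 ?(symA 2%:R 1) ?(symB 2%:R 1) ?(symA 1 0) a01.
  by rewrite (symB 1 0) b01; lra.
have [c [s [cs Ha Hb]]] := common_rotation par.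
have [a [a0 Da]] := axis_rotation_diag As A0 Ha.
have [b [b0 Db]] := axis_rotation_diag Bs B0 Hb.
exists (axis_rotation c s), a, b; split=> //.
exact: axis_rotation_orthogonal.
Qed.

End CommonEigenbasis.

(** * Differentials of maps into S^3 x S^3 *)

Section Differentials.
Context {R : realType}.

Lemma is_diff_linear (V W : normedModType R) (g : {linear V -> W}) (x : V) :
  continuous g -> is_diff x g g.
Proof.
by move=> cg; split; [exact: linear_differentiable | exact: diff_lin].
Qed.

Lemma is_diff_fst (V W : normedModType R) (x : V * W) : is_diff x fst fst.
Proof.
apply: (@is_diff_linear (V * W)%type V (@fst V W)) => z.
by apply: cvg_fst.
Qed.

Lemma is_diff_snd (V W : normedModType R) (x : V * W) : is_diff x snd snd.
Proof.
apply: (@is_diff_linear (V * W)%type W (@snd V W)) => z.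
by apply: cvg_snd.
Qed.

Lemma is_diff_sum (V W : normedModType R) n (f df : 'I_n -> V -> W) (x : V) :
  (forall i, is_diff x (f i) (df i)) ->
  is_diff x (fun y => \sum_i f i y) (fun v => \sum_i df i v).
Proof.
elim: n f df => [|n IH] f df fdf.
  under eq_fun do rewrite big_ord0.
  under [X in is_diff _ _ X]eq_fun do rewrite big_ord0.
  exact: is_diff_cst.
under eq_fun do rewrite big_ord_recl.
under [X in is_diff _ _ X]eq_fun do rewrite big_ord_recl.
by apply: is_diffD; apply: IH.
Qed.

Lemma is_diff_coord n (u : 'rV[R]_n) i :
  is_diff u (fun v : 'rV[R]_n => v 0 i : R) (fun v => v 0 i).
Proof.
have lin : linear (fun v : 'rV[R]_n => v 0 i : R).
  by move=> a v w; rewrite !mxE.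
pose f : {linear 'rV[R]_n -> R} := HB.pack (fun v : 'rV[R]_n => v 0 i : R)
  (GRing.isLinear.Build _ _ _ _ _ lin).
have cf : continuous f by move=> v; exact: (@coord_continuous _ 1 n 0 i v).
exact: (is_diff_linear _ cf).
Qed.

Lemma is_diff_qdot (V : normedModType R) (F dF : V -> quat R) (x : V) :
  is_diff x F dF ->
  is_diff x (fun y => qdot (F y) (F y)) (fun v => 2 * qdot (F x) (dF v)).
Proof.
move=> FdF.
have Di i : is_diff x (fun y => F y 0 i : R) (fun v => dF v 0 i).
  exact: (is_diff_comp FdF (is_diff_coord _ i)).
apply: is_diff_eq (is_diff_sum (fun i => is_diffM (Di i) (Di i))) _.
apply/funext => v; rewrite /qdot mulr_sumr; apply: eq_bigr => i _ /=.
by rewrite mulr_natl mulr2n.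
Qed.

Lemma sphere_tangent (V : normedModType R) (F : V -> quat R) (x : V) :
  (forall y, S3 (F y)) -> differentiable F x ->
  forall v, qdot (F x) ('d F x v) = 0.
Proof.
move=> FS dF v; have D := is_diff_qdot (differentiableP dF).
have E : (fun y => qdot (F y) (F y)) = cst 1.
  by apply/funext => y; exact: FS.
case: D => _; rewrite E diff_cst => /(congr1 (fun h => h v)) /= /esym /eqP.
by rewrite mulf_eq0 pnatr_eq0 /= => /eqP.
Qed.

End Differentials.

Section SmoothMaps.
Context {R : realType} {M : manifold 'rV[R]_3}.
Context (f : M -> quat R * quat R) (fsmooth : smooth f).

Lemma smooth_differentiable x :
  differentiable (f \o chart_inv (chart_at x)) (chart_map (chart_at x) x).
Proof.
have [+ _] := fsmooth (chart_at_atlas x) 1%N; apply.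
by exists x => //; exact: chart_at_dom.
Qed.

Lemma f_chartK x : f (chart_inv (chart_at x) (chart_map (chart_at x) x)) = f x.
Proof. by rewrite chart_mapK //; exact: chart_at_dom. Qed.

Lemma mdiff_fst x X : mdiff (fst \o f) x X = (mdiff f x X).1.
Proof.
have [_ D] := is_diff_comp (differentiableP (smooth_differentiable x))
                           (is_diff_fst _).
by rewrite /mdiff -compA D.
Qed.

Lemma mdiff_snd x X : mdiff (snd \o f) x X = (mdiff f x X).2.
Proof.
have [_ D] := is_diff_comp (differentiableP (smooth_differentiable x))
                           (is_diff_snd _).
by rewrite /mdiff -compA D.
Qed.

Lemma mdiff_tangent x X : (forall y, (S3 `*` S3) (f y)) ->
  qdot (f x).1 (mdiff f x X).1 = 0 /\ qdot (f x).2 (mdiff f x X).2 = 0.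
Proof.
move=> fS; rewrite -mdiff_fst -mdiff_snd.
have df := differentiableP (smooth_differentiable x).
set c := chart_at x in df *; split.
  have := @sphere_tangent R 'rV[R]_3 (fst \o f \o chart_inv c) (chart_map c x).
  rewrite /= f_chartK; apply; last by case: (is_diff_comp df (is_diff_fst _)).
  by move=> y; have [] := fS (chart_inv c y).
have := @sphere_tangent R 'rV[R]_3 (snd \o f \o chart_inv c) (chart_map c x).
rewrite /= f_chartK; apply; last by case: (is_diff_comp df (is_diff_snd _)).
by move=> y; have [] := fS (chart_inv c y).
Qed.

Lemma mrank_fst_lt3 x : (mrank (fst \o f) x < 3)%N <->
  exists2 X : 'rV[R]_3, X != 0 & (mdiff f x X).1 = 0.
Proof.
rewrite /mrank; set g := (mdiff _ _ : 'rV_3 -> 'rV_4).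
have gE X : X *m lin1_mx g = (mdiff f x X).1.
  by rewrite -mdiff_fst /g /mdiff mul_rV_lin1.
rewrite ltn_neqAle rank_leq_row andbT; split.
  rewrite -/(row_free _) -kermx_eq0 => /rowV0Pn[X].
  by rewrite sub_kermx gE => /eqP ? ?; exists X.
case=> X X0 X1; apply/negP => fr; move/negP: X0; apply.
by rewrite -(mulmx_free_eq0 _ fr) gE X1.
Qed.

End SmoothMaps.

(** * Lagrangian immersions *)

Section Lagrangian.
Context {R : realType} {M : manifold 'rV[R]_3}.
Context (f : M -> quat R * quat R) (hf : lagrangian_immersion f).

(** The differential of f in left-translated coordinates. *)
Definition ltrans_diff_mx (x : M) : 'M[R]_(3, 3 + 3) :=
  \matrix_i ltrans_coord (f x) (mdiff f x (delta_mx 0 i)).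

Lemma mdiff_ltrans x X : mdiff f x X = ltrans (f x) (X *m ltrans_diff_mx x).
Proof.
have [fS [fs _] _] := hf.
rewrite mulmx_sum_row linear_sum {1}[X]row_sum_delta {1}/mdiff linear_sum.
apply: eq_bigr => i _; rewrite !linearZ /= rowK ltrans_coordK //;
by have [] := mdiff_tangent fs (delta_mx 0 i : 'rV[R]_3) fS (x := x).
Qed.

Lemma nkg_mdiff x X Y : nkg (f x) (mdiff f x X) (mdiff f x Y) =
  (X *m (ltrans_diff_mx x *m nkGmx *m (ltrans_diff_mx x)^T) *m Y^T) 0 0.
Proof.
have [fS _ _] := hf.
by rewrite !mdiff_ltrans nkg_ltrans // trmx_mul !mulmxA.
Qed.

Lemma bilinear_mx_eq0 m n (W : 'M[R]_(m, n)) :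
  (forall (X : 'rV_m) (Y : 'rV_n), (X *m W *m Y^T) 0 0 = 0) -> W = 0.
Proof.
move=> H; apply/matrixP => i j; have := H (delta_mx 0 i) (delta_mx 0 j).
by rewrite -rowE trmx_delta -colE !mxE.
Qed.

Lemma ltrans_diff_lagrangian x :
  ltrans_diff_mx x *m nkJmx *m nkGmx *m (ltrans_diff_mx x)^T = 0.
Proof.
have [fS _ lag] := hf; apply: bilinear_mx_eq0 => X Y.
rewrite -(lag x X Y) !mdiff_ltrans nkJ_ltrans // nkg_ltrans //.
by rewrite trmx_mul !mulmxA.
Qed.

Lemma ltrans_diff_pos x (v : 'rV_3) : v != 0 ->
  0 < (v *m (ltrans_diff_mx x *m nkGmx *m (ltrans_diff_mx x)^T) *m v^T) 0 0.
Proof.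
move=> v0; rewrite -nkg_mdiff; apply: nkg_gt0.
have [_ [_ inj] _] := hf; apply: contra v0 => /eqP H; apply/eqP.
by apply: (inj x); rewrite H mdiff_ltrans mul0mx raddf0.
Qed.

Lemma ker_dp_coord x X : (mdiff f x X).1 = 0 ->
  X *m ltrans_diff_mx x = row_mx 0 (rsubmx (X *m ltrans_diff_mx x)).
Proof.
have [fS _ _] := hf; have [hp _] := fS x.
rewrite mdiff_ltrans -{2}[X *m _]hsubmxK /= => H; congr row_mx.
have := congr1 (qmul (qinv (f x).1)) H; rewrite qmulVK // raddf0 => {}H.
rewrite -[LHS]quat_of_imK H.
by apply/rowP; elim/ord3P; rewrite !mxE /= /qi /qj /qk mxE.
Qed.

(** The angles are indexed so that the kernel vector X becomes, up to a scalar,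
    the vector of index 0. *)
Lemma angle_frame x (X : 'rV[R]_3) : X != 0 -> (mdiff f x X).1 = 0 ->
  exists th : 'I_3 -> R, th 0 = pi / 3 /\
    exists (A B : {linear 'rV[R]_3 -> 'rV[R]_3}) (e : 'I_3 -> 'rV[R]_3),
      [/\ @product_decomposition R M f x A B,
          @orthonormal_frame R M f x e &
          forall i, A (e i) = cos (2 * th i) *: e i /\
                    B (e i) = sin (2 * th i) *: e i].
Proof.
move=> X0 X1; have [fS _ _] := hf.
set T := ltrans_diff_mx x; set G3 := T *m nkGmx *m T^T.
have Gsym : G3^T = G3 by rewrite /G3 !trmx_mul trmxK nkGmx_sym mulmxA.
have [E [c [EG E0]]] := orthonormal_basis3 Gsym (@ltrans_diff_pos x) X0.
pose Z := E *m T.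
have Zon : Z *m nkGmx *m Z^T = 1%:M by rewrite -EG /Z /G3 trmx_mul !mulmxA.
have Zlag : Z *m nkJmx *m nkGmx *m Z^T = 0.
  rewrite /Z trmx_mul -!mulmxA [T *m (_ *m _)]mulmxA [T *m nkJmx *m _]mulmxA.
  by rewrite [_ *m (T^T *m _)]mulmxA ltrans_diff_lagrangian mul0mx mulmx0.
have Zrow : row 0 Z *m nkPmx =
    - 2^-1 *: row 0 Z + (Num.sqrt 3 / 2) *: (row 0 Z *m nkJmx).
  rewrite /Z row_mul E0 -scalemxAl (ker_dp_coord X1) -!scalemxAl ker_dp_eigen.
  by rewrite scalerDr !scalerA ![c * _]mulrC.
have [A0 B0] := frame_row (@nkJmx2 R) (@nkJGmx R) Zon Zlag Zrow.
have dec := frame_decomp nkPmx (@nkJmx2 R) (@nkJGmx R) Zon Zlag.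
have [AA AB] :=
  frameAB (@nkJmx2 R) (@nkPmx2 R) (@nkPJmx R) (@nkJGmx R) Zon Zlag.
have As := frameA_sym (@nkPGmx R) (@nkGmx_sym R) Z.
have Bs := frameB_sym (@nkPJmx R) (@nkJGmx R) (@nkPGmx R) (@nkGmx_sym R) Z.
have [Q [a [b [QQ a0 b0 Da Db]]]] := common_eigenbasis As Bs AB A0 B0.
move: (frameA _ _ _) (frameB _ _ _ _) dec AA Da Db {AB As Bs A0 B0}.
move=> A B dec AA Da Db.
have QTQ := mulmx1C QQ.
have ab i : a 0 i ^+ 2 + b 0 i ^+ 2 = 1.
  have H : diag_mx a *m diag_mx a + diag_mx b *m diag_mx b = 1%:M.
    rewrite -Da -Db !mulmxA -(mulmxA _ Q^T Q) QTQ mulmx1.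
    rewrite -(mulmxA _ Q^T Q) QTQ mulmx1.
    by rewrite -mulmxDl -(mulmxA Q A) -(mulmxA Q B) -mulmxDr AA mulmx1.
  have := congr1 (fun W : 'M[R]_3 => W i i) H.
  by rewrite !mulmx_diag !mxE eqxx !mulr1n -!expr2.
have /choice [th thP] : forall i, exists t : R,
    (cos (2 * t) = a 0 i /\ sin (2 * t) = b 0 i) /\ (i = 0 -> t = pi / 3).
  move=> i; have [->|i0] := eqVneq i 0.
    by exists (pi / 3); rewrite a0 b0; have [-> ->] := @cos_sin_2pi3 R.
  have [t ht] := double_polar_angle (ab i); exists t; split=> // i0'.
  by rewrite i0' eqxx in i0.
exists th; split; first by have [_ ->] := thP 0.
pose E' := Q *m E.
have EG' : E' *m G3 *m E'^T = 1%:M.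
  have -> : E' *m G3 *m E'^T = Q *m (E *m G3 *m E^T) *m Q^T.
    by rewrite /E' trmx_mul !mulmxA.
  by rewrite EG mulmx1.
have Eu : E' \in unitmx by move: EG'; rewrite -mulmxA => /mulmx1_unit[].
pose LA : 'M[R]_3 := invmx E' *m diag_mx a *m E'.
pose LB : 'M[R]_3 := invmx E' *m diag_mx b *m E'.
have dec' : E' *m T *m nkPmx =
    diag_mx a *m E' *m T + diag_mx b *m E' *m T *m nkJmx.
  rewrite /E' -(mulmxA Q E T) -/Z -(mulmxA Q Z) dec mulmxDr -Da -Db.
  by rewrite -!(mulmxA _ Q^T) !(mulmxA Q^T Q) QTQ !mul1mx /Z !mulmxA.
exists (mulmxr LA), (mulmxr LB), (fun i => row i E'); split.
- move=> Y; rewrite !mdiff_ltrans nkP_ltrans // nkJ_ltrans // -raddfD /=.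
  congr ltrans; have {1}-> : Y = Y *m invmx E' *m E' by rewrite mulmxKV.
  rewrite -/T -(mulmxA _ E' T) -(mulmxA _ _ nkPmx) dec' mulmxDr.
  by rewrite /LA /LB !mulmxA.
- move=> i j; rewrite nkg_mdiff -/T -/G3 tr_row -row_mul.
  have <- : (E' *m G3 *m E'^T) i j = (i == j)%:R by rewrite EG' mxE.
  by rewrite [LHS]mxE [RHS]mxE; apply: eq_bigr => k _; rewrite !mxE.
- move=> i; have [[-> ->] _] := thP i; split.
  + rewrite /= -row_mul /LA -mulmxA mulKVmx //.
    by rewrite row_mul row_diag_mx -scalemxAl -rowE.
  + rewrite /= -row_mul /LB -mulmxA mulKVmx //.
    by rewrite row_mul row_diag_mx -scalemxAl -rowE.
Qed.

End Lagrangian.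

Theorem theorem1 (R : realType) (M : manifold 'rV[R]_3)
    (f : M -> quat R * quat R) (hf : lagrangian_immersion f) :
  ((forall x : M, (mrank (fst \o f) x < 3)%N) ->
   exists h : M -> R, is_angle_function f h /\
     forall x : M, exists k : int, h x = pi / 3 + k%:~R * pi) /\
  ((exists h : M -> R, is_angle_function f h /\
     forall x : M, exists k : int, h x = pi / 3 + k%:~R * pi) ->
   forall x : M, (mrank (fst \o f) x < 3)%N).
Proof.
have [fS [fs _] _] := hf; split.
  move=> rk.
  have /choice[th thP] : forall x, exists th : 'I_3 -> R, th 0 = pi / 3 /\
    exists (A B : {linear 'rV[R]_3 -> 'rV[R]_3}) (e : 'I_3 -> 'rV[R]_3),
      [/\ @product_decomposition R M f x A B,
          @orthonormal_frame R M f x e &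
          forall i, A (e i) = cos (2 * th i) *: e i /\
                    B (e i) = sin (2 * th i) *: e i].
    move=> x; have /(mrank_fst_lt3 fs)[X X0 X1] := rk x.
    exact: (angle_frame hf X0 X1).
  exists (fun x => th x 0); split; last first.
    by move=> x; exists 0; have [-> _] := thP x; rewrite mul0r addr0.
  exists (fun i x => th x i), 0; split=> // x.
  by have [_ H] := thP x.
case=> h [[th [i [thP thh]]] hk] x.
have [A [B [e [dec on eig]]]] := thP x.
have [k hkx] := hk x; have [ei1 ei2] := eig i.
move: ei1 ei2; rewrite thh hkx.
have [-> ->] := cos_sin_double_periodz (pi / 3 : R) k.
have [-> ->] := @cos_sin_2pi3 R => ei1 ei2.
apply/(mrank_fst_lt3 fs); exists (e i).
  apply/eqP => e0; have := on i i.
  rewrite eqxx e0 mdiff_ltrans // mul0mx nkg_ltrans // !mul0mx mxE.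
  by move/esym/eqP; rewrite oner_eq0.
apply: (angle_pi3_ker (fS x)); have := dec (e i).
by rewrite ei1 ei2 /mdiff !linearZ.
Qed.
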